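(* Fix $n$ and an integer $k$ with $0\le k<\lfloor n/2\rfloor$. Then, as $q\to\infty$, uniformly over all irreducible representations $\rho$ of $GL_n(\mathbb F_q)$ of $U$-rank $k$, $$\frac{\chi_\rho(T)}{\dim(\rho)}=\frac{1}{q^k}+o\!\left(\frac1{q^k}\right).$$
   Context: $T$ is the transvection (identity matrix with an additional entry $T_{12}=1$); $\chi_\rho$ is the character of $\rho$. Fix a nontrivial additive character $\psi$ of $\mathbb F_q$ and let $a=\lfloor n/2\rfloor$. $U=\{\begin{pmatrix} I_a & A\\ 0& I_{n-a}\end{pmatrix}: A\in M_{a,n-a}(\mathbb F_q)\}$, identified with $M_{a,n-a}$; its characters are $\psi_B(A)=\psi(\mathrm{trace}(B^tA))$, $B\in M_{a,n-a}$. The $U$-rank of a representation $\rho$ of $GL_n(\mathbb F_q)$ is the maximum of $\mathrm{rank}(B)$ over all $B$ such that $\psi_B$ occurs in $\rho|_U$. *)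

(* Defs.v *)
From HB Require Import structures.
From mathcomp Require Import all_boot all_order all_algebra all_fingroup all_solvable all_field all_character.
Set Implicit Arguments. Unset Strict Implicit. Unset Printing Implicit Defensive.
Import Order.TTheory GRing.Theory Num.Theory.
Local Open Scope ring_scope.

(* Matrices in {'GL_n[F]} have size n.-1.+1, which equals n when n > 0.
   Indices are converted with inord. a = n./2 = floor(n/2). *)

(* nontrivial additive character psi : (F,+) -> algC^x *)
Definition nontriv_add_char (F : finFieldType) (psi : F -> algC) : Prop :=
  [/\ psi 0 = 1, (forall x y, psi (x + y) = psi x * psi y) & exists x, psi x != 1].

(* the transvection T = I + E_{12} (indices 0,1 in 0-based numbering) *)
Definition transv_mx (n : nat) (F : finFieldType) : 'M[F]_n.-1.+1 :=
  1%:M + delta_mx 0 (inord 1).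

Definition transv (n : nat) (F : finFieldType) : {'GL_n[F]} :=
  insubd (1%g : {'GL_n[F]}) (transv_mx n F).

(* g lies in U = { [[I_a, A],[0, I_{n-a}]] } *)
Definition inU (n : nat) (F : finFieldType) (g : {'GL_n[F]}) : bool :=
  let a := n./2 in
  [forall i : 'I_n.-1.+1, forall j : 'I_n.-1.+1,
     (((i < a)%N == (j < a)%N) ==> (GLval g i j == (i == j)%:R))
     && (((a <= i)%N && (j < a)%N) ==> (GLval g i j == 0))].

Definition Uset (n : nat) (F : finFieldType) : {set {'GL_n[F]}} :=
  [set g | inU g].

(* psi_B(g) = psi(trace(B^t A)) where A is the upper-right a x (n-a) block of g *)
Definition psiB (n : nat) (F : finFieldType) (psi : F -> algC)
    (B : 'M[F]_(n./2, n - n./2)) (g : {'GL_n[F]}) : algC :=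
  psi (\tr (B^T *m \matrix_(i < n./2, j < n - n./2)
                     GLval g (inord i) (inord (n./2 + j)))).

(* psi_B occurs in chi|_U : the multiplicity '[Res_U chi, psi_B]_U, written out, is nonzero *)
Definition occursB (n : nat) (F : finFieldType) (psi : F -> algC)
    (chi : 'CF([set: {'GL_n[F]}])) (B : 'M[F]_(n./2, n - n./2)) : bool :=
  (#|Uset n F|%:R^-1 * \sum_(g in Uset n F) chi g * (psiB psi B g)^*) != 0.

(* U-rank: max rank of B such that psi_B occurs in chi|_U *)
Definition Urank (n : nat) (F : finFieldType) (psi : F -> algC)
    (chi : 'CF([set: {'GL_n[F]}])) : nat :=
  \max_(B : 'M[F]_(n./2, n - n./2) | occursB psi chi B) \rank B.

(* Main.v *)
Require Import Defs.
From HB Require Import structures.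
From mathcomp Require Import all_boot all_order all_algebra all_fingroup all_solvable all_field all_character.
From mathcomp Require Import ring zify.
Set Implicit Arguments. Unset Strict Implicit. Unset Printing Implicit Defensive.
Import Order.TTheory GRing.Theory Num.Theory.
Local Open Scope ring_scope.

(**
Write q = #|F|, a = floor(n/2), b = n - a, and let R be the character ratio at a
transvection.

Lower bound. The multiplicities of the psi_B in chi|_U are nonnegative and vanish for
rank B > k. Averaging chi over the matrices x f with x a column and f a row of the
a x b block gives (q^a - 1)(q^b - 1) R + q^a + q^b - 1 >= q^(n-k).

Upper bound. The class sum of transvections acts on the chi-isotypic functions on GL_n
by a scalar, so R is bounded by the expectation of that sum on any one function v.
Some psi_B with rank B = k occurs, hence there are a k-dimensional space Y and a v <> 0
on which the group 1 + Y (x) Y^perp acts by a character that is injective on Y. For a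
vector x, the transvections 1 + x f with f x = 0 form a group, whose sum is a multiple
of the projection Pi_x onto its invariants. Conjugating by 1 + Y (x) Y^perp shows that
|Pi_x v| depends only on x + Y when x is not in Y, and the Pi_(x+y) v with y in Y are
essentially orthogonal, so |Pi_x v|^2 <= q^(-k) |v|^2 for all but few x; for x in Y it
vanishes. Both bounds are q^(-k) (1 + O(1/q)) because 2k + 2 <= n.
*)

(** * Irreducible characters: convolution, positivity and class sums *)

Section IrreducibleCharacters.

Variables (gT : finGroupType) (G : {group gT}) (i : Iirr G).

(** The generalized orthogonality relation, with the summation variable shifted so that the
    character becomes a kernel of inner products of its own translates. *)
Lemma irr_convolution (x y : gT) : x \in G -> y \in G ->
  'chi_i (x * y^-1)%g =
    'chi_i 1%g / #|G|%:R * \sum_(g in G) 'chi_i (g * x)%g * ('chi_i (g * y)%g)^*.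
Proof.
move=> Gx Gy; have := generalized_orthogonality_relation (x * y^-1)%g i i.
rewrite eqxx mul1r => /esym/(canRL (divfK (irr1_neq0 i))) ->.
rewrite mulrC mulrA; congr (_ * _).
rewrite (reindex_inj (mulgI y)) /=; apply: eq_big => g; first by rewrite groupMl.
rewrite groupMl // => Gg; rewrite -char_inv ?irr_char //.
congr (_ * _).
  by rewrite -(cfunJ _ _ Gy) conjgE !mulgA mulVg mul1g -!mulgA mulVg mulg1.
by rewrite -(cfunJ _ _ Gy) conjgE !invMg !mulgA mulgKV.
Qed.

(** By the convolution formula the double sum is a nonnegative multiple of the sum over g of the
    squares |sum_j c_j chi (g h_j)|^2. *)
Lemma irr_posdef (J : finType) (c : J -> algC) (h : J -> gT) :
    (forall j, h j \in G) ->
  0 <= \sum_j \sum_k c j * (c k)^* * 'chi_i (h j * (h k)^-1)%g.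
Proof.
move=> Gh.
have -> : \sum_j \sum_k c j * (c k)^* * 'chi_i (h j * (h k)^-1)%g =
    'chi_i 1%g / #|G|%:R *
      \sum_(g in G) `|\sum_j c j * 'chi_i (g * h j)%g| ^+ 2.
  transitivity (\sum_j \sum_k \sum_(g in G) 'chi_i 1%g / #|G|%:R *
      (c j * 'chi_i (g * h j)%g * (c k * 'chi_i (g * h k)%g)^*)).
    apply: eq_bigr => j _; apply: eq_bigr => k _.
    rewrite irr_convolution // !mulr_sumr; apply: eq_bigr => g _.
    by rewrite rmorphM /=; ring.
  under eq_bigr => j _ do rewrite exchange_big.
  rewrite exchange_big mulr_sumr; apply: eq_bigr => g _ /=.
  rewrite normCK rmorph_sum mulr_suml mulr_sumr; apply: eq_bigr => j _.
  by rewrite !mulr_sumr.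
rewrite mulr_ge0 ?divr_ge0 ?ler0n ?char1_ge0 ?irr_char //.
by apply: sumr_ge0 => g _; rewrite exprn_ge0.
Qed.

(** The sum of the conjugates of the matrix of [t] commutes with the representation, so it is scalar
    by Schur's lemma. Its trace determines the scalar; the trace of its product with the matrix of
    [z] is the left side. *)
Lemma irr_conjg_sum (t z : gT) : t \in G -> z \in G ->
  \sum_(g in G) 'chi_i (t ^ g * z)%g = #|G|%:R * ('chi_i t * 'chi_i z / 'chi_i 1%g).
Proof.
move=> Gt Gz; pose rG := 'Chi_i; pose M := \sum_(g in G) rG (t ^ g)%g.
have cM : centgmx rG M.
  apply/centgmxP => x Gx; rewrite mulmx_suml mulmx_sumr.
  rewrite (reindex_inj (mulIg x^-1)%g) /=.
  apply: eq_big => g; first by rewrite groupMr ?groupV.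
  rewrite groupMr ?groupV // => Gg.
  rewrite -!repr_mxM ?groupJ ?groupM ?groupV //; congr (rG _).
  by rewrite conjgM (conjgE _ x^-1) invgK -!mulgA mulVg mulg1.
have irrG : mx_absolutely_irreducible rG.
  exact: (groupC (socle_irr _)).
have [c Mc] := is_scalar_mxP (mx_abs_irr_cent_scalar irrG cM).
have chiE x : x \in G -> 'chi_i x = \tr (rG x).
  by move=> Gx; rewrite -irrRepr cfunE Gx mulr1n.
have tM : \tr M = #|G|%:R * 'chi_i t.
  rewrite raddf_sum mulr_natl -sumr_const; apply: eq_bigr => g Gg /=.
  by rewrite -chiE ?groupJ // cfunJ.
have tMz : \tr (M *m rG z) = \sum_(g in G) 'chi_i (t ^ g * z)%g.
  rewrite mulmx_suml raddf_sum; apply: eq_bigr => g Gg /=.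
  by rewrite -repr_mxM ?groupJ // -chiE // groupM // groupJ.
have c1 : c * 'chi_i 1%g = #|G|%:R * 'chi_i t.
  by rewrite -tM Mc mxtrace_scalar chiE // repr_mx1 mxtrace1 mulr_natr.
rewrite -tMz Mc mul_scalar_mx mxtraceZ -chiE // !mulrA -c1.
by rewrite mulrAC mulfK ?irr1_neq0.
Qed.

End IrreducibleCharacters.

(** * Additive characters of F and Fourier sums over matrix spaces *)

Section AdditiveCharacters.

Variables (F : finFieldType) (psi : F -> algC).
Hypothesis psi_char : nontriv_add_char psi.

Let psi0 : psi 0 = 1. Proof. by case: psi_char. Qed.
Let psiD x y : psi (x + y) = psi x * psi y. Proof. by case: psi_char. Qed.

Lemma sum_nontriv_hom (V : finZmodType) (h : V -> algC) (x0 : V) :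
  (forall x y, h (x + y) = h x * h y) -> h x0 != 1 -> \sum_x h x = 0.
Proof.
move=> hD hx0; apply/eqP; have: h x0 * \sum_x h x == \sum_x h x.
  rewrite mulr_sumr [X in _ == X](reindex_inj (addrI x0)) /=.
  by apply/eqP; apply: eq_bigr => x _; rewrite hD.
rewrite -subr_eq0 -{2}[\sum_x _]mul1r -mulrBl mulf_eq0 subr_eq0.
by rewrite (negPf hx0).
Qed.

(** In characteristic p the values are p-th roots of unity. *)
Lemma add_char_norm x : `|psi x| = 1.
Proof.
have [p p_pr charFp] := finPcharP F.
have psiX j : psi x ^+ j = psi (x *+ j).
  by elim: j => [|j IHj]; rewrite ?expr0 ?psi0 // exprS mulrS psiD IHj.
have: `|psi x| ^+ p == 1 by rewrite -normrX psiX (mulrn_pchar charFp) psi0 normr1.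
by rewrite pexpr_eq1 ?prime_gt0 // => /eqP.
Qed.

Lemma add_char_conj x : (psi x)^* = psi (- x).
Proof.
have nz : psi x != 0 by rewrite -normr_eq0 add_char_norm oner_eq0.
apply: (mulfI nz); rewrite -psiD subrr psi0.
by rewrite -normCK add_char_norm expr1n.
Qed.

Lemma add_char_tr_trivial (m p : nat) (M : 'M[F]_(m, p)) :
  (forall A, psi (\tr (M *m A)) = 1) -> M = 0.
Proof.
move=> M1; apply/matrixP => i j; rewrite !mxE; apply/eqP; apply: contraT => Mij.
have [_ _ [c /eqP[]]] := psi_char.
(* The test matrix is supported on one entry and pairs with [M] to the trace [c], where [psi c]
   differs from 1. *)
rewrite -[RHS](M1 ((c / M i j) *: delta_mx j i)); congr psi.
rewrite -scalemxAr mxtraceZ /mxtrace (bigD1 i) //= big1 ?addr0 => [|l li].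
  rewrite mxE (bigD1 j) //= big1 ?addr0 => [|l lj]; rewrite !mxE ?eqxx ?mulr1.
    by rewrite divfK.
  by rewrite (negPf lj) mulr0.
by rewrite mxE big1 // => l' _; rewrite !mxE (negPf li) andbF mulr0.
Qed.

Lemma sum_add_char_tr (m p : nat) (M : 'M[F]_(m, p)) :
  \sum_(A : 'M[F]_(p, m)) psi (\tr (M *m A)) = (M == 0)%:R * (#|F| ^ (p * m))%:R.
Proof.
have [-> | /eqP nzM] := eqVneq M 0.
  under eq_bigr => A _ do rewrite mul0mx mxtrace0 psi0.
  by rewrite sumr_const mul1r card_mx.
rewrite mul0r.
have [A0 A0M | ] := pickP (fun A => psi (\tr (M *m A)) != 1); last first.
  by move=> M1; case: nzM; apply: add_char_tr_trivial => A; have /negbFE/eqP := M1 A.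
by apply: sum_nontriv_hom A0M => A A'; rewrite mulmxDr mxtraceD psiD.
Qed.

Lemma sum_add_char_trT (m p : nat) (M : 'M[F]_(m, p)) :
  \sum_(B : 'M[F]_(m, p)) psi (\tr (B^T *m M)) = (M == 0)%:R * (#|F| ^ (m * p))%:R.
Proof.
rewrite mulnC -sum_add_char_tr (reindex (@trmx F p m)) /=; last first.
  by apply: onW_bij; exists trmx; apply: trmxK.
by apply: eq_bigr => B _; rewrite trmxK mxtrace_mulC.
Qed.

End AdditiveCharacters.

(** * Cardinalities of left and right kernels *)

Section KernelCount.

Variable F : finFieldType.

Lemma card_row_ker (m p : nat) (M : 'M[F]_(m, p)) :
  #|[set u : 'rV[F]_m | u *m M == 0]| = (#|F| ^ (m - \rank M))%N.
Proof.
rewrite -mxrank_ker -card_rowg; apply: eq_card => u.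
by rewrite mem_rowg inE; apply/eqP/sub_kermxP.
Qed.

Lemma card_col_ker (m p : nat) (M : 'M[F]_(m, p)) :
  #|[set x : 'cV[F]_p | M *m x == 0]| = (#|F| ^ (p - \rank M))%N.
Proof.
rewrite -mxrank_tr -card_row_ker -(card_imset _ (@trmx_inj _ _ _)).
apply: eq_card => u; rewrite inE; apply/imsetP/eqP => [[x + ->]|uM].
  by rewrite inE -trmx_mul => /eqP->; rewrite trmx0.
exists u^T; last by rewrite trmxK.
by rewrite inE -[M]trmxK -trmx_mul uM trmx0.
Qed.

End KernelCount.

(** * Matrix coefficients of translations, averaged over abelian groups *)

Section TranslationAverages.

Variables (F : finFieldType) (N : nat) (v : 'M[F]_N -> algC).

(** The inner product of the translate of [v] by [M] with [v] itself. Functions live on the whole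
    matrix algebra, which left multiplication by an invertible matrix still permutes. *)
Definition matcoef (M : 'M[F]_N) : algC := \sum_z v (M *m z) * (v z)^*.

Lemma sum_mulmx_unit (M : 'M[F]_N) (f : 'M[F]_N -> algC) :
  M \in unitmx -> \sum_z f (M *m z) = \sum_z f z.
Proof.
by move=> uM; rewrite [RHS](reindex_inj (can_inj (mulKmx uM))).
Qed.

Variables (W : finZmodType) (u : W -> 'M[F]_N) (V : {set W}).
Hypothesis V0 : 0 \in V.
Hypothesis VB : forall a b, a \in V -> b \in V -> a - b \in V.
Hypothesis u0 : u 0 = 1%:M.
Hypothesis uD : forall a b, a \in V -> b \in V -> u (a + b) = u a *m u b.

(** Translations by units are unitary, so the inner product of the translates by [u a] and [u b]
    depends only on a - b. For fixed a in V this difference runs over V with b, and the choice of a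
    no longer matters. *)
Lemma sum_matcoef_cross (S : {set W}) : S \subset V ->
  \sum_z (\sum_(a in S) v (u a *m z)) * (\sum_(b in V) v (u b *m z))^* =
    #|S|%:R * \sum_(a in V) matcoef (u a).
Proof.
move=> /subsetP sSV.
have VN a : a \in V -> - a \in V by move=> Va; rewrite -sub0r VB.
have uU a : a \in V -> u a \in unitmx.
  by move=> Va; have [] := mulmx1_unit (etrans (esym (uD Va (VN a Va)))
    (etrans (congr1 u (subrr a)) u0)).
transitivity (\sum_(a in S) \sum_(b in V)
    \sum_z v (u a *m z) * (v (u b *m z))^*).
  under eq_bigr => z _ do rewrite mulr_suml.
  rewrite exchange_big; apply: eq_bigr => a Sa /=.
  under eq_bigr => z _ do rewrite rmorph_sum mulr_sumr.
  by rewrite exchange_big.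
rewrite mulr_natl -sumr_const; apply: eq_bigr => a Sa; have Va := sSV a Sa.
have binj : injective (fun b => a - b) by move=> b b' /addrI/oppr_inj.
rewrite (reindex_inj binj) /=; apply: eq_big => b.
  apply/idP/idP => Vb; last exact: VB.
  by rewrite -[b](subKr a) VB.
move=> Vab; have Vb : b \in V by rewrite -[b](subKr a) VB.
rewrite /matcoef -[RHS](sum_mulmx_unit _ (uU _ Vab)); apply: eq_bigr => z _.
by rewrite mulmxA -uD // [b + _]addrC subrK.
Qed.

(** With S = V the cross sum is a squared norm. *)
Lemma sum_matcoef_ge0 : 0 <= \sum_(a in V) matcoef (u a).
Proof.
have cV : 0 < #|V|%:R :> algC by rewrite ltr0n; apply/card_gt0P; exists 0.
rewrite -(pmulr_rge0 _ cV) -sum_matcoef_cross //.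
by apply: sumr_ge0 => z _; rewrite -normCK exprn_ge0.
Qed.

End TranslationAverages.

(* The projections onto the invariants of V and of its subgroup D are nested, so
   the former has the smaller expectation on v; the square integrated below is the
   squared norm of their difference, up to scaling. *)
Lemma mean_matcoef_le (F : finFieldType) (N : nat) (v : 'M[F]_N -> algC)
    (W : finZmodType) (u : W -> 'M[F]_N) (V D : {set W}) :
    0 \in V -> (forall a b, a \in V -> b \in V -> a - b \in V) ->
    0 \in D -> (forall a b, a \in D -> b \in D -> a - b \in D) ->
    D \subset V -> u 0 = 1%:M ->
    (forall a b, a \in V -> b \in V -> u (a + b) = u a *m u b) ->
  #|D|%:R * \sum_(a in V) matcoef v (u a) <= #|V|%:R * \sum_(a in D) matcoef v (u a).
Proof.
move=> V0 VB D0 DB sDV u0 uD.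
have uD' a b : a \in D -> b \in D -> u (a + b) = u a *m u b.
  by move=> Da Db; rewrite uD // (subsetP sDV).
pose SV z := \sum_(a in V) v (u a *m z); pose SD z := \sum_(a in D) v (u a *m z).
set sV := \sum_(a in V) _; set sD := \sum_(a in D) _.
have VV : \sum_z SV z * (SV z)^* = #|V|%:R * sV by apply: sum_matcoef_cross.
have DD : \sum_z SD z * (SD z)^* = #|D|%:R * sD by apply: sum_matcoef_cross.
have DV : \sum_z SD z * (SV z)^* = #|D|%:R * sV by apply: sum_matcoef_cross.
have sVreal : sV^* = sV by apply/CrealP/ger0_real/sum_matcoef_ge0.
have VD : \sum_z SV z * (SD z)^* = #|D|%:R * sV.
  transitivity ((\sum_z SD z * (SV z)^*)^*).
    by rewrite rmorph_sum; apply: eq_bigr => z _; rewrite rmorphM /= conjCK mulrC.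
  by rewrite DV rmorphM /= conjC_nat sVreal.
have cV : 0 < #|V|%:R :> algC by rewrite ltr0n; apply/card_gt0P; exists 0.
have cD : 0 < #|D|%:R :> algC by rewrite ltr0n; apply/card_gt0P; exists 0.
rewrite -subr_ge0 -(pmulr_rge0 _ cV) -(pmulr_rge0 _ cD).
have -> : #|D|%:R * (#|V|%:R * (#|V|%:R * sD - #|D|%:R * sV)) =
    \sum_z `|#|V|%:R * SD z - #|D|%:R * SV z| ^+ 2.
  transitivity (#|V|%:R ^+ 2 * (\sum_z SD z * (SD z)^*)
     - #|V|%:R * #|D|%:R * (\sum_z SD z * (SV z)^*)
     - #|V|%:R * #|D|%:R * (\sum_z SV z * (SD z)^*)
     + #|D|%:R ^+ 2 * (\sum_z SV z * (SV z)^*)); first by rewrite VV DD DV VD; ring.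
  rewrite !mulr_sumr -!sumrB -big_split; apply: eq_bigr => z _ /=.
  by rewrite normCK rmorphB !rmorphM /= !conjC_nat; ring.
by apply: sumr_ge0 => z _; rewrite exprn_ge0.
Qed.

(** * Expectation of the sum of transvections on a function with an injective character *)

Section UpperBound.

Variables (F : finFieldType) (psi : F -> algC).
Hypothesis psi_char : nontriv_add_char psi.
(** The columns of [P] span the space Y, which is the kernel of [Q], and the rows of [Q] are a basis
    of its annihilator. [Bfree] is the injectivity on Y: for nonzero [w] the character psi (tr (B^T
    w a)) of the row [a] is nontrivial. *)
Variables (N k m : nat) (P : 'M[F]_(N, k)) (Q : 'M[F]_(m, N)) (B : 'M[F]_(k, m)).
Variable v : 'M[F]_N -> algC.
Hypothesis QP0 : Q *m P = 0.
Hypothesis kerQ : forall x : 'cV_N, Q *m x = 0 -> exists w, x = P *m w.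
Hypothesis Qfree : row_free Q.
Hypothesis Bfree : row_free B.
Hypothesis vU : forall (A : 'M_(k, m)) z,
  v ((1%:M + P *m A *m Q) *m z) = psi (\tr (B^T *m A)) * v z.

Let q : algC := #|F|%:R.
Let E := matcoef v 1%:M.
(** For nonzero [x] this is q^(N-1) times the squared norm of Pi_x v, while [E] is the squared norm
    of v. *)
Let s (x : 'cV[F]_N) := \sum_(f : 'rV_N | f *m x == 0) matcoef v (1%:M + x *m f).

Let E_ge0 : 0 <= E.
Proof. by apply: sumr_ge0 => z _; rewrite mul1mx -normCK exprn_ge0. Qed.

Let transvD (x : 'cV[F]_N) (f g : 'rV_N) : f *m x = 0 ->
  1%:M + x *m (f + g) = (1%:M + x *m f) *m (1%:M + x *m g).
Proof.
move=> fx; rewrite mulmxDl !mulmxDr !mul1mx mulmx1 -!mulmxA [f *m (x *m g)]mulmxA fx.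
by rewrite mul0mx mulmx0 addr0 -addrA [x *m g + _]addrC.
Qed.

Let perp_set (x : 'cV[F]_N) : {set 'rV[F]_N} := [set f | f *m x == 0].

Let sE x : s x = \sum_(f in perp_set x) matcoef v (1%:M + x *m f).
Proof. by apply: eq_bigl => f; rewrite inE. Qed.

Let card_perp x : x != 0 -> #|perp_set x| = (#|F| ^ N.-1)%N.
Proof.
move=> nzx; rewrite card_row_ker; congr (_ ^ _)%N.
have -> : \rank x = 1%N; last exact: subn1.
by apply/eqP; rewrite eqn_leq rank_leq_col lt0n mxrank_eq0.
Qed.

Lemma transvection_sum_mean_le x (D : {set 'rV[F]_N}) :
    0 \in D -> (forall f g, f \in D -> g \in D -> f - g \in D) ->
    D \subset perp_set x ->
  #|D|%:R * s x <= #|perp_set x|%:R * \sum_(f in D) matcoef v (1%:M + x *m f).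
Proof.
move=> D0 DB sD; rewrite sE; apply: (mean_matcoef_le v) => //.
- by rewrite inE mul0mx.
- by move=> f g; rewrite !inE mulmxBl => /eqP-> /eqP->; rewrite subrr.
- by rewrite mulmx0 addr0.
- by move=> f g; rewrite inE => /eqP fx _; apply: transvD.
Qed.

(** The functionals that vanish both on Y and at [x]. Comparing with this smaller group helps
    because, for x in Y, its transvections have the form 1 + P A Q and act on [v] by a known
    character. *)
Let Dset (x : 'cV[F]_N) : {set 'rV[F]_N} :=
  [set a *m Q | a in [set a : 'rV_m | a *m (Q *m x) == 0]].

Let mulQ_inj : injective (fun a : 'rV_m => a *m Q).
Proof. exact: (row_free_inj Qfree). Qed.

Let Dset_closed x : [/\ 0 \in Dset x,
  (forall f g, f \in Dset x -> g \in Dset x -> f - g \in Dset x) &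
  Dset x \subset perp_set x].
Proof.
split.
- by apply/imsetP; exists 0; rewrite ?inE ?mul0mx.
- move=> _ _ /imsetP[a + ->] /imsetP[b + ->]; rewrite !inE => /eqP ax /eqP bx.
  by apply/imsetP; exists (a - b); rewrite ?inE ?mulmxBl // ax bx subrr.
- apply/subsetP => _ /imsetP[a + ->]; rewrite !inE => /eqP ax.
  by rewrite -mulmxA ax.
Qed.

(** Here x = P w lies in Y, and the transvections from [Dset x] act on [v] by a character of [a]
    that is nontrivial because [B] is row free. Its sum vanishes, and the nested projections
    transfer the bound to [s x]. *)
Lemma transvection_sum_le0 x : x != 0 -> Q *m x = 0 -> s x <= 0.
Proof.
move=> nzx Qx0; have [w xE] := kerQ Qx0.
have [D0 DB sD] := Dset_closed x; have := transvection_sum_mean_le D0 DB sD.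
suff -> : \sum_(f in Dset x) matcoef v (1%:M + x *m f) = 0.
  rewrite mulr0 pmulr_rle0 // ltr0n; apply/card_gt0P; by exists 0.
rewrite big_imset /=; last by move=> a b _ _; apply: mulQ_inj.
transitivity (\sum_(a : 'rV_m) psi (\tr (B^T *m w *m a)) * E).
  apply: eq_big => [a|a _]; first by rewrite inE Qx0 mulmx0 eqxx.
  rewrite /E /matcoef mulr_sumr; apply: eq_bigr => z _.
  by rewrite mul1mx mulrA -mulmxA -vU xE !mulmxA.
rewrite -mulr_suml sum_add_char_tr // [_ == 0](_ : _ = false) ?mul0r //.
apply: contra_neqF nzx => /eqP/(congr1 trmx); rewrite trmx_mul trmxK trmx0.
rewrite -(mul0mx _ B) => /(row_free_inj Bfree) /(congr1 trmx).
by rewrite trmxK trmx0 xE => ->; rewrite mulmx0.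
Qed.

(** An element g = 1 + P A Q with A Q x = w sends x to x + P w and conjugates one transvection group
    into the other. It multiplies [v] by a number of modulus 1, which cancels in the matrix
    coefficients. *)
Lemma transvection_sum_shift x w : Q *m x != 0 -> s (x + P *m w) = s x.
Proof.
move=> nzQx.
have [A AQx] : exists A : 'M_(k, m), A *m (Q *m x) = w.
  have /row_fullP[C CQx] : row_full (Q *m x).
    by rewrite /row_full eqn_leq rank_leq_col lt0n mxrank_eq0.
  by exists (w *m C); rewrite -mulmxA CQx mulmx1.
pose M := P *m A *m Q; pose g := 1%:M + M; pose g' := 1%:M - M.
have MM : M *m M = 0 by rewrite /M -!mulmxA [Q *m (P *m _)]mulmxA QP0 !mul0mx !mulmx0.
have gg' : g *m g' = 1%:M.
  by rewrite /g /g' mulmxDl mul1mx mulmxBr mulmx1 MM subr0 subrK.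
have [ug _] := mulmx1_unit gg'; have g'g := mulmx1C gg'.
have gx : g *m x = x + P *m w by rewrite /g /M mulmxDl mul1mx -!mulmxA AQx.
rewrite -gx /s (reindex_inj (can_inj (mulmxK (mulmx1_unit g'g).1))) /=.
apply: eq_big => [f|f _].
  by rewrite -!mulmxA [g' *m _]mulmxA g'g mul1mx.
have -> : 1%:M + g *m x *m (f *m g') = g *m (1%:M + x *m f) *m g'.
  by rewrite mulmxDr mulmx1 mulmxDl gg' !mulmxA.
rewrite /matcoef -(sum_mulmx_unit _ ug); apply: eq_bigr => z _.
rewrite -!mulmxA [g' *m _]mulmxA g'g mul1mx /g /M !vU rmorphM /= mulrACA.
by rewrite -normCK add_char_norm // expr1n mul1r.
Qed.

Let ann (x : 'cV[F]_N) : {set 'rV[F]_m} :=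
  [set a | (a *m B^T == 0) && (a *m (Q *m x) == 0)].

(** This is the near orthogonality of the shifted projections. The value of [s] is the same at all x
    + P w, and bounding each by its [Dset] sum introduces the phase psi (tr (a B^T w)). Averaging
    over [w] leaves only the rows [a] in [ann x], whose group sum is at most its order times [E]. *)
Lemma transvection_sum_le x : Q *m x != 0 ->
  q ^+ m.-1 * s x <= q ^+ N.-1 * (#|ann x|%:R * E).
Proof.
move=> nzQx; have nzx : x != 0 by apply: contraNneq nzQx => ->; rewrite mulmx0.
have cD : #|Dset x|%:R = q ^+ m.-1.
  rewrite (card_imset _ mulQ_inj) card_row_ker -natrX; congr ((_ ^ _)%:R).
  have -> : \rank (Q *m x) = 1%N; last exact: subn1.
  by apply/eqP; rewrite eqn_leq rank_leq_col lt0n mxrank_eq0.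
have DE w : Dset (x + P *m w) = Dset x.
  by rewrite /Dset mulmxDr [Q *m (P *m w)]mulmxA QP0 mul0mx addr0.
have Qxw w : Q *m (x + P *m w) != 0 by rewrite mulmxDr mulmxA QP0 mul0mx addr0.
have bound w : q ^+ m.-1 * s x <= q ^+ N.-1 *
    \sum_(a : 'rV_m | a *m (Q *m x) == 0)
      psi (\tr (a *m B^T *m w)) * matcoef v (1%:M + x *m (a *m Q)).
  have nzxw : x + P *m w != 0 by apply: contraNneq (Qxw w) => ->; rewrite mulmx0.
  have [D0 DB sD] := Dset_closed (x + P *m w); have := transvection_sum_mean_le D0 DB sD.
  rewrite DE cD transvection_sum_shift // card_perp // natrX -/q.
  congr (_ <= _ * _); rewrite big_imset /=; last by move=> a b _ _; apply: mulQ_inj.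
  apply: eq_big => [a|a]; rewrite inE // => /eqP ax.
  (* As a Q x = 0, the transvection 1 + (x + P w) a Q factors as (1 + P w a Q) (1 + x a Q), and [vU]
     turns the first factor into a phase. *)
  rewrite /matcoef mulr_sumr; apply: eq_bigr => z _; rewrite mulrA; congr (_ * _).
  rewrite -mulmxA mxtrace_mulC -[B^T *m w *m a]mulmxA -vU mulmxA.
  congr (v (_ *m z)); rewrite [RHS]mulmxDr mulmx1 [X in _ = _ + X]mulmxDl mul1mx.
  have -> : P *m (w *m a) *m Q *m (x *m (a *m Q)) = 0.
    by rewrite -!mulmxA [Q *m (x *m _)]mulmxA [a *m (_ *m _)]mulmxA ax mul0mx !mulmx0.
  by rewrite addr0 mulmxDl addrA addrAC !mulmxA.
(* Comparison with the trivial subgroup: a projection does not increase the norm of [v]. *)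
have annle : \sum_(a in ann x) matcoef v (1%:M + x *m (a *m Q)) <= #|ann x|%:R * E.
  have := @mean_matcoef_le F N v _ (fun a : 'rV_m => 1%:M + x *m (a *m Q)) (ann x) [set 0].
  rewrite cards1 mul1r big_set1 mul0mx mulmx0 addr0; apply=> //.
  - by rewrite inE !mul0mx !eqxx.
  - move=> a b; rewrite !inE !mulmxBl => /andP[/eqP-> /eqP->] /andP[/eqP-> /eqP->].
    by rewrite !subrr !eqxx.
  - by rewrite inE.
  - by move=> a b /set1P-> /set1P->; rewrite subrr inE.
  - by rewrite sub1set inE !mul0mx !eqxx.
  - move=> a b; rewrite inE => /andP[_ /eqP ax] _; rewrite [(a + b) *m Q]mulmxDl transvD //.
    by rewrite -mulmxA.
have q_gt0 : 0 < q by rewrite ltr0n; apply/card_gt0P; exists 0.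
apply: le_trans (_ : q ^+ N.-1 * \sum_(a in ann x) matcoef v (1%:M + x *m (a *m Q)) <= _).
  (* The factor q^k counts the columns [w], so that the bounds for all [w] can be added up. *)
  rewrite -(ler_pM2l (exprn_gt0 k q_gt0)).
  have -> : q ^+ k * (q ^+ m.-1 * s x) = \sum_(w : 'cV[F]_k) q ^+ m.-1 * s x.
    by rewrite sumr_const card_mx muln1 -[RHS]mulr_natl natrX.
  apply: le_trans (ler_sum _ (fun w _ => bound w)) _.
  rewrite le_eqVlt; apply/orP; left; apply/eqP.
  rewrite -mulr_sumr exchange_big mulrCA; congr (_ * _); rewrite mulr_sumr /=.
  rewrite [RHS]big_mkcond [LHS]big_mkcond; apply: eq_bigr => a _.
  rewrite inE andbC; case: (_ *m _ == 0) => //=.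
  rewrite -mulr_suml sum_add_char_tr // muln1 natrX.
  by case: (_ == 0); rewrite ?mul1r ?mul0r.
by rewrite ler_wpM2l // exprn_ge0 // ltW.
Qed.

(** Vectors of Y contribute at most 0. For the others the cardinals of [ann x] are summed by double
    counting over the q^(m-k) rows with a B^T = 0: the zero row accounts for at most q^N vectors,
    every other one for q^(N-1). *)
Lemma sum_transvection_sum_le : (0 < m)%N ->
  q ^+ m.-1 * \sum_(x | x != 0) s x <=
    q ^+ N.-1 * (q ^+ N + q ^+ (m - k) * q ^+ N.-1) * E.
Proof.
move=> m_gt0; have q_ge0 : 0 <= q by rewrite ler0n.
rewrite (bigID (fun x => Q *m x == 0)) /= mulrDr -[leRHS]add0r lerD //.
  rewrite -oppr_ge0 -mulrN mulr_ge0 ?exprn_ge0 // oppr_ge0.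
  rewrite -oppr_ge0 -sumrN; apply: sumr_ge0 => x /andP[nzx /eqP Qx0].
  by rewrite oppr_ge0; apply: transvection_sum_le0.
rewrite mulr_sumr; apply: le_trans (_ : \sum_x q ^+ N.-1 * (#|ann x|%:R * E) <= _).
  rewrite [leRHS](bigID (fun x => (x != 0) && (Q *m x != 0))) /= -[leLHS]addr0.
  apply: lerD; last first.
    by apply: sumr_ge0 => x _; rewrite !mulr_ge0 ?exprn_ge0 ?ler0n.
  by apply: ler_sum => x /andP[_]; apply: transvection_sum_le.
rewrite -mulr_sumr -mulrA ler_wpM2l ?exprn_ge0 // -mulr_suml ler_wpM2r //.
have -> : \sum_x #|ann x|%:R =
    \sum_(a : 'rV[F]_m | a *m B^T == 0) #|[set x : 'cV[F]_N | a *m Q *m x == 0]|%:R :> algC.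
  rewrite -!natr_sum; congr (_%:R).
  under eq_bigr => x _ do rewrite -sum1_card.
  under [RHS]eq_bigr => x _ do rewrite -sum1_card.
  rewrite (exchange_big_dep (fun a : 'rV[F]_m => a *m B^T == 0)) /=; last first.
    by move=> x a _; rewrite inE => /andP[].
  apply: eq_bigr => a aB; apply: eq_bigl => x.
  by rewrite !inE aB -mulmxA.
rewrite (bigD1 0) ?mul0mx //=; apply: lerD.
  by rewrite -natrX ler_nat card_col_ker leq_pexp2l ?leq_subr //; apply/card_gt0P; exists 0.
apply: le_trans (_ : \sum_(a : 'rV[F]_m | a *m B^T == 0) q ^+ N.-1 <= _); last first.
  rewrite sumr_const -[leLHS]mulr_natl -cardsE card_row_ker mxrank_tr.
  by rewrite (eqP Bfree) natrX.
rewrite [leRHS](bigD1 0) ?mul0mx //= -[leLHS]add0r lerD ?exprn_ge0 //.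
apply: ler_sum => a /andP[_ nza]; rewrite card_col_ker natrX.
have -> : \rank (a *m Q) = 1%N; last by rewrite subn1.
apply/eqP; rewrite eqn_leq rank_leq_row lt0n mxrank_eq0.
by rewrite -(mul0mx _ Q) (inj_eq mulQ_inj).
Qed.

(** Pairing the eigenvalue equation with [v] gives sum_x s x = L E, and [E] is positive. *)
Lemma eigenvalue_le (L : algC) : (0 < m)%N -> (exists z, v z != 0) ->
    (forall z, \sum_(x : 'cV_N | x != 0) \sum_(f : 'rV_N | f *m x == 0)
                  v ((1%:M + x *m f) *m z) = L * v z) ->
  q ^+ m.-1 * L <= q ^+ N.-1 * (q ^+ N + q ^+ (m - k) * q ^+ N.-1).
Proof.
move=> m_gt0 [z0 vz0] vL; have := sum_transvection_sum_le m_gt0.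
have E_gt0 : 0 < E.
  rewrite lt_def E_ge0 andbT /E /matcoef psumr_neq0 => [|z _]; last first.
    by rewrite mul1mx -normCK exprn_ge0.
  apply/hasP; exists z0; first exact: mem_index_enum.
  by rewrite mul1mx -normCK exprn_gt0 // normr_gt0.
have -> : \sum_(x | x != 0) s x = L * E.
  rewrite /E /matcoef mulr_sumr.
  under [RHS]eq_bigr => z _ do rewrite mul1mx mulrA -vL mulr_suml.
  rewrite exchange_big; apply: eq_bigr => x nzx /=.
  under [RHS]eq_bigr => z _ do rewrite mulr_suml.
  by rewrite exchange_big.
by rewrite mulrA ler_pM2r.
Qed.

End UpperBound.

(** * Conjugacy of all nontrivial transvections *)

Section Transvections.

Variable F : finFieldType.

Lemma row0_unitmx (p : nat) (f : 'rV[F]_p.+1) : f != 0 ->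
  exists2 h, h \in unitmx & delta_mx 0 0 *m h = f.
Proof.
move=> nzf; pose c := col_ebase f 0 0.
have rk1 : \rank f = 1%N by apply/eqP; rewrite eqn_leq rank_leq_row lt0n mxrank_eq0.
have cE : col_ebase f = c%:M by apply: mx11_scalar.
have uc : c \is a GRing.unit.
  by have := col_ebase_unit f; rewrite cE unitmxE det_scalar1.
exists (c *: row_ebase f); first by rewrite unitmxZ // row_ebase_unit.
rewrite -[RHS]mulmx_ebase cE rk1 mul_scalar_mx -scalemxAl -scalemxAr.
congr (_ *: (_ *m _)); apply/matrixP => i j; rewrite !mxE !ord1.
by case: j => [[|j] jlt].
Qed.

(** First an invertible [k1] moves the first basis vector to [x]. The condition f x = 0 then says
    that f k1 has first entry 0, so a block diagonal matrix, which fixes the first basis vector, can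
    normalise the remaining entries. *)
Lemma transvection_frame (p : nat) (x : 'cV[F]_p.+2) (f : 'rV[F]_p.+2) :
    x != 0 -> f != 0 -> f *m x = 0 ->
  exists g, [/\ g \in unitmx, g *m delta_mx 0 0 = x & f *m g = delta_mx 0 (inord 1)].
Proof.
move=> nzx nzf fx0.
have [|h0 uh0 h0x] := @row0_unitmx _ x^T; first by rewrite -trmx0 (inj_eq trmx_inj).
pose k1 := h0^T; have uk1 : k1 \in unitmx by rewrite unitmx_tr.
have k1x : k1 *m delta_mx 0 0 = x by rewrite -[x]trmxK -h0x trmx_mul trmx_delta.
pose f1 : 'rV[F]_(1 + p.+1) := f *m k1.
have lf1 : lsubmx f1 = 0.
  apply/matrixP => i j; rewrite !ord1 [LHS]mxE [RHS]mxE.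
  have -> : lshift p.+1 (0 : 'I_1) = 0 :> 'I_(1 + p.+1) by apply: val_inj.
  have := congr1 (fun M : 'M_1 => M 0 0) fx0.
  by rewrite -k1x mulmxA -colE mxE [RHS]mxE.
have f1E : f1 = row_mx 0 (rsubmx f1) by rewrite -{1}[f1]hsubmxK lf1.
have nzf1 : rsubmx f1 != 0.
  apply: contraNneq nzf => r0; have f10 : f1 = 0 by rewrite f1E r0 row_mx0.
  by rewrite -[f](mulmxK uk1) -/f1 f10 mul0mx.
have [h2' uh2' h2f] := row0_unitmx nzf1.
pose h2 : 'M[F]_(1 + p.+1) := block_mx 1%:M 0 0 h2'.
have uh2 : h2 \in unitmx by rewrite unitmxE det_ublock det1 mul1r -unitmxE.
have h2e : h2 *m delta_mx 0 0 = delta_mx 0 0 :> 'cV_(1 + p.+1).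
  have -> : delta_mx 0 0 = delta_mx (lshift p.+1 0) 0 :> 'cV[F]_(1 + p.+1).
    by congr delta_mx; apply: val_inj.
  by rewrite delta_mx_ushift mul_block_col !mulmx0 mul0mx mul1mx !addr0.
have e1E : delta_mx 0 (inord 1) = row_mx 0 (delta_mx 0 0) :> 'rV[F]_(1 + p.+1).
  by rewrite -delta_mx_rshift; congr delta_mx; apply: val_inj; rewrite /= inordK.
have e1h2 : (row_mx 0 (delta_mx 0 0) : 'rV[F]_(1 + p.+1)) *m h2 = f1.
  by rewrite mul_row_block !mul0mx mulmx0 !add0r h2f -f1E.
exists (k1 *m invmx h2); split.
- by rewrite unitmx_mul uk1 unitmx_inv.
- by rewrite -mulmxA -[delta_mx 0 0 in LHS]h2e mulKmx.
- by rewrite mulmxA -/f1 -e1h2 mulmxK // -e1E.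
Qed.

End Transvections.

(** * Characters of GL_n as functions on matrices *)

Section GLCharacters.

Variables (F : finFieldType) (n : nat).
Notation N := n.-1.+1.
Variable i : Iirr [set: {'GL_n[F]}].

Definition toGL (M : 'M[F]_N) : {'GL_n[F]} := insubd (1%g : {'GL_n[F]}) M.

(** The character extended by zero to singular matrices, so that it is a function on the whole
    matrix algebra. The test also shields it from the default value 1 of [toGL]. *)
Definition glchar (M : 'M[F]_N) : algC :=
  if M \in unitmx then 'chi_i (toGL M) else 0.

Lemma toGLK (M : 'M[F]_N) : M \in unitmx -> GLval (toGL M) = M.
Proof. by move=> uM; rewrite -[LHS]/(val (toGL M)) insubdK. Qed.

Lemma GLvalK (g : {'GL_n[F]}) : toGL (GLval g) = g.
Proof. by apply: val_inj; rewrite /= insubdK //; apply: GL_unitmx. Qed.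

Lemma toGLM (A B : 'M[F]_N) : A \in unitmx -> B \in unitmx ->
  toGL (A *m B) = (toGL A * toGL B)%g.
Proof.
move=> uA uB; apply: val_inj; rewrite [LHS]insubdK; last first.
  by rewrite -topredE /= unitmx_mul uA.
by rewrite [RHS]GL_MxE !toGLK.
Qed.

Lemma toGLV (A : 'M[F]_N) : A \in unitmx -> toGL (invmx A) = (toGL A)^-1%g.
Proof.
move=> uA; apply: val_inj; rewrite [LHS]insubdK; last first.
  by rewrite -topredE /= unitmx_inv.
by rewrite [RHS]GL_VxE toGLK.
Qed.

Lemma glchar_GLval g : glchar (GLval g) = 'chi_i g.
Proof. by rewrite /glchar GL_unitmx GLvalK. Qed.

Lemma glchar1 : glchar 1%:M = 'chi_i 1%g.
Proof. by rewrite -glchar_GLval. Qed.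

Lemma glcharJ (g M : 'M[F]_N) : g \in unitmx ->
  glchar (invmx g *m M *m g) = glchar M.
Proof.
move=> ug; rewrite /glchar !unitmx_mul unitmx_inv ug andbT /=.
case: ifP => // uM; rewrite !toGLM ?unitmx_mul ?unitmx_inv ?ug // toGLV //.
by rewrite -mulgA -conjgE cfunJ // inE.
Qed.

Lemma glchar_posdef (J : finType) (c : J -> algC) (h : J -> 'M[F]_N) :
    (forall j, h j \in unitmx) ->
  0 <= \sum_j \sum_k c j * (c k)^* * glchar (h j *m invmx (h k)).
Proof.
move=> uh; have := @irr_posdef _ _ i J c (fun j => toGL (h j)) (fun j => in_setT _).
congr (_ <= _); apply: eq_bigr => j _; apply: eq_bigr => k _; congr (_ * _).
by rewrite /glchar unitmx_mul unitmx_inv !uh /= toGLM ?unitmx_inv // toGLV.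
Qed.

Lemma glchar_conj_sum (t z : 'M[F]_N) : t \in unitmx -> z \in unitmx ->
  \sum_(g : {'GL_n[F]}) glchar (invmx (GLval g) *m t *m GLval g *m z) =
    #|[set: {'GL_n[F]}]|%:R * (glchar t / glchar 1%:M * glchar z).
Proof.
move=> ut uz; have := @irr_conjg_sum _ _ i (toGL t) (toGL z) (in_setT _) (in_setT _).
rewrite [glchar t]/glchar [glchar z]/glchar ut uz glchar1 mulrAC => <-.
apply: eq_big => g; first by rewrite inE.
have ug := GL_unitmx g; move=> _.
rewrite -GL_VxE -(toGLK ut) -(toGLK uz) -!GL_MxE glchar_GLval.
by rewrite conjgE !mulgA !GLvalK.
Qed.

End GLCharacters.

(** * Isotypic components under the groups 1 + P A Q *)

Section Components.

Variables (F : finFieldType) (psi : F -> algC).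
Hypothesis psi_char : nontriv_add_char psi.
Variable N : nat.

Let psi0 : psi 0 = 1. Proof. by case: psi_char. Qed.
Let psiD x y : psi (x + y) = psi x * psi y. Proof. by case: psi_char. Qed.

Definition unip r s (P : 'M[F]_(N, r)) (Q : 'M[F]_(s, N)) (A : 'M[F]_(r, s)) :=
  1%:M + P *m A *m Q.

Lemma unipD r s (P : 'M[F]_(N, r)) (Q : 'M[F]_(s, N)) A A' : Q *m P = 0 ->
  unip P Q (A + A') = unip P Q A *m unip P Q A'.
Proof.
move=> QP0; rewrite /unip [RHS]mulmxDl mul1mx mulmxDr mulmx1.
have -> : P *m A *m Q *m (P *m A' *m Q) = 0.
  by rewrite -!mulmxA [Q *m (P *m _)]mulmxA QP0 !mul0mx !mulmx0.
by rewrite addr0 mulmxDr mulmxDl addrA addrAC.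
Qed.

Lemma unip0 r s (P : 'M[F]_(N, r)) (Q : 'M[F]_(s, N)) : unip P Q 0 = 1%:M.
Proof. by rewrite /unip mulmx0 mul0mx addr0. Qed.

Lemma unip_unit r s (P : 'M[F]_(N, r)) (Q : 'M[F]_(s, N)) A : Q *m P = 0 ->
  unip P Q A \in unitmx.
Proof.
by move=> QP0; have [] := @mulmx1_unit _ _ (unip P Q A) (unip P Q (- A));
  rewrite // -unipD // subrr unip0.
Qed.

Lemma unipV r s (P : 'M[F]_(N, r)) (Q : 'M[F]_(s, N)) A : Q *m P = 0 ->
  invmx (unip P Q A) = unip P Q (- A).
Proof.
move=> QP0; rewrite -[LHS]mulmx1 -(unip0 P Q) -(subrr A) unipD //.
by rewrite mulKmx // unip_unit.
Qed.

(** The unnormalised projection of [w] onto the functions that translation by [unip P Q A]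
    multiplies by psi (tr (B^T A)). *)
Definition component r s (P : 'M[F]_(N, r)) (Q : 'M[F]_(s, N)) (B : 'M[F]_(r, s))
    (w : 'M[F]_N -> algC) (z : 'M[F]_N) : algC :=
  \sum_(A : 'M[F]_(r, s)) psi (- \tr (B^T *m A)) * w (unip P Q A *m z).

(* Each transvection is counted #|F| - 1 times, as x runs over a punctured line, and
   the pairs (x, 0) contribute copies of the identity. *)
Definition transv_eigen (L : algC) (w : 'M[F]_N -> algC) : Prop :=
  forall g z, g \in unitmx ->
    \sum_(x : 'cV_N | x != 0) \sum_(f : 'rV_N | f *m x == 0)
       w (g *m ((1%:M + x *m f) *m z)) = L * w (g *m z).

Lemma component_equivariant r s (P : 'M[F]_(N, r)) (Q : 'M[F]_(s, N)) B w A z :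
    Q *m P = 0 ->
  component P Q B w (unip P Q A *m z) = psi (\tr (B^T *m A)) * component P Q B w z.
Proof.
move=> QP0; rewrite /component [in RHS](reindex_inj (addIr A)) mulr_sumr /=.
apply: eq_bigr => A' _; rewrite mulmxA -unipD // mulrA -psiD; congr (psi _ * _).
by rewrite mulmxDr mxtraceD opprD addrCA subrr addr0.
Qed.

(** Fourier inversion: the components at [z] add up over all [B] to a nonzero multiple of w z. *)
Lemma component_neq0 r s (P : 'M[F]_(N, r)) (Q : 'M[F]_(s, N)) (w : 'M[F]_N -> algC) z :
  w z != 0 -> exists B, component P Q B w z != 0.
Proof.
move=> wz; apply/existsP; apply: contraT => /existsPn comp0.
have : \sum_B component P Q B w z = 0.
  by apply: big1 => B _; apply/eqP; have := comp0 B; rewrite negbK.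
rewrite exchange_big /= (bigD1 0) //= [X in _ + X]big1 => [|A nzA].
  under eq_bigr => B _ do rewrite mulmx0 mxtrace0 oppr0 psi0 mul1r unip0 mul1mx.
  rewrite sumr_const addr0 => /eqP; rewrite mulrn_eq0 (negPf wz) orbF.
  by rewrite -[_ == _]/(#|{: 'M[F]_(r, s)}| == 0%N) card_mx expn_eq0;
    case: #|F| (finRing_gt1 F).
rewrite -mulr_suml; under eq_bigr => B _ do rewrite -raddfN -mulmxN.
by rewrite sum_add_char_trT // oppr_eq0 (negPf nzA) !mul0r.
Qed.

(** The factor [g] in [transv_eigen] serves this purpose: it absorbs the translations from which a
    component is built. *)
Lemma component_eigen r s (P : 'M[F]_(N, r)) (Q : 'M[F]_(s, N)) B L w :
  Q *m P = 0 -> transv_eigen L w -> transv_eigen L (component P Q B w).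
Proof.
move=> QP0 wL g z ug; rewrite /component mulr_sumr.
under eq_bigr => x _ do rewrite exchange_big.
rewrite exchange_big; apply: eq_bigr => A _ /=.
under eq_bigr => x _ do rewrite -mulr_sumr.
rewrite -mulr_sumr mulrCA; congr (_ * _); rewrite mulmxA -wL ?unitmx_mul ?unip_unit //.
by apply: eq_bigr => x _; apply: eq_bigr => f _; rewrite !mulmxA.
Qed.

(** The two vanishing conditions annihilate the cross products P A Q P' A' Q' and P' A' Q' P A Q, so
    the two groups commute. *)
Lemma component_commute r s r' s' (P : 'M[F]_(N, r)) (Q : 'M[F]_(s, N)) B w
    (P' : 'M[F]_(N, r')) (Q' : 'M[F]_(s', N)) A' c :
    Q *m P' = 0 -> Q' *m P = 0 ->
    (forall z, w (unip P' Q' A' *m z) = c * w z) ->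
  forall z, component P Q B w (unip P' Q' A' *m z) = c * component P Q B w z.
Proof.
move=> QP' Q'P wA z; rewrite /component mulr_sumr; apply: eq_bigr => A _.
rewrite mulrCA -wA !mulmxA; congr (_ * w (_ *m _)).
rewrite /unip !mulmxDl !mulmxDr !mul1mx !mulmx1.
rewrite -[P *m A *m Q *m _]mulmxA -[P' *m A' *m Q' *m _]mulmxA.
rewrite [Q *m _]mulmxA [Q *m _]mulmxA QP' [Q' *m _]mulmxA [Q' *m _]mulmxA Q'P.
by rewrite !mul0mx !mulmx0 !addr0 -!addrA [P *m A *m Q + _]addrC.
Qed.

(* Passing from the a x b block to the block Y (x) Y^perp, where Y is a complement
   of the kernel of B0, makes the character injective on Y. *)
Lemma component_eigenvalue_le a b (PX : 'M[F]_(N, a)) (QX : 'M[F]_(b, N))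
    (LX : 'M[F]_(a, N)) (B0 : 'M[F]_(a, b)) (v0 : 'M[F]_N -> algC) (L : algC) r :
    QX *m PX = 0 -> LX *m PX = 1%:M -> \rank B0 = r -> (r < N)%N ->
    (exists z, v0 z != 0) -> transv_eigen L v0 ->
    (forall A z, v0 (unip PX QX A *m z) = psi (\tr (B0^T *m A)) * v0 z) ->
  #|F|%:R ^+ (N - r).-1 * L <=
    #|F|%:R ^+ N.-1 * (#|F|%:R ^+ N + #|F|%:R ^+ (N - r - r) * #|F|%:R ^+ N.-1).
Proof.
move=> QPX LPX <- {r} rN [z0 v0z] v0L v0U; set r := \rank B0 in rN *.
(* [C] selects from the column space of [PX] an r-dimensional subspace Y, spanned by [P], on which
   the form of [B0] keeps its full rank: C^T B0 is a row basis of [B0]. *)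
pose C := (pinvmx (col_base B0))^T; pose P := PX *m C.
have CB : C^T *m B0 = row_base B0.
  transitivity (C^T *m (col_base B0 *m row_base B0)); first by rewrite mulmx_base.
  by rewrite trmxK mulmxA mulVpmx ?col_base_full ?mul1mx.
pose Lf := (col_base B0)^T *m LX.
have LP : Lf *m P = 1%:M.
  rewrite /Lf /P mulmxA -[_ *m LX *m PX]mulmxA LPX mulmx1 -[RHS]trmx1.
  by rewrite -(mulVpmx (col_base_full B0)) [RHS]trmx_mul.
have rkP : \rank P = r by apply/eqP/row_fullP; exists Lf.
pose Q := row_base (kermx P).
have QP : Q *m P = 0 by apply/sub_kermxP; rewrite eq_row_base.
have kerQ (x : 'cV_N) : Q *m x = 0 -> exists w, x = P *m w.
  move=> Qx; exists (Lf *m x).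
  have : (1%:M - P *m Lf <= Q)%MS.
    by rewrite eq_row_base; apply/sub_kermxP; rewrite mulmxBl mul1mx -mulmxA LP mulmx1 subrr.
  case/submxP => D /(congr1 (fun M => M *m x)); rewrite -mulmxA Qx mulmx0 mulmxBl mul1mx.
  by move/eqP; rewrite subr_eq0 -mulmxA => /eqP.
have [D QXE] : exists D, QX = D *m Q.
  by apply/submxP; rewrite eq_row_base; apply/sub_kermxP; rewrite /P mulmxA QPX mul0mx.
have [B vz] := component_neq0 P Q v0z; set v := component P Q B v0 in vz.
have Bfree : row_free B.
  (* The elements 1 + P A QX lie in both groups, since QX = D Q. Their action on [v] is computed
     once through [v0] and once through the component [B]; equality of the two characters gives B0^T
     C = D B^T, which forces [B] to have rank r. *)
  have DB : B0^T *m C - D *m B^T = 0.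
    apply: (add_char_tr_trivial psi_char) => A.
    have vA z : v (unip P QX A *m z) = psi (\tr (B0^T *m C *m A)) * v z.
      apply: component_commute => [||z']; first by rewrite QP.
      - by rewrite /P mulmxA QPX mul0mx.
      - by rewrite -mulmxA -v0U /unip /P !mulmxA.
    have vA' z : v (unip P QX A *m z) = psi (\tr (D *m B^T *m A)) * v z.
      rewrite -mulmxA mxtrace_mulC -mulmxA -component_equivariant //.
      by rewrite /unip QXE !mulmxA.
    have nz : psi (\tr (D *m B^T *m A)) != 0.
      by rewrite -normr_eq0 add_char_norm // oner_eq0.
    have := vA' z0; rewrite vA => /(mulIf vz) eqpsi.
    apply: (mulIf nz); rewrite -psiD -mxtraceD -mulmxDl subrK eqpsi.
    by rewrite mul1r.
  have /(congr1 trmx) : B0^T *m C = D *m B^T by apply/eqP; rewrite -subr_eq0 DB.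
  rewrite trmx_mul (trmxK B0) CB trmx_mul trmxK => rbE.
  rewrite /row_free eqn_leq rank_leq_row /=.
  by rewrite -{1}(eqP (row_base_free B0)) rbE mxrankM_maxl.
have rkQ : \rank (kermx P) = (N - r)%N by rewrite mxrank_ker rkP.
rewrite -rkQ; apply: (@eigenvalue_le F psi psi_char N r _ P Q B v) => //.
- exact: row_base_free.
- by move=> A z; apply: component_equivariant.
- by rewrite rkQ subn_gt0.
- by exists z0.
- move=> z; have := component_eigen B QP v0L z (unitmx1 _ _).
  rewrite mul1mx => <-; apply: eq_bigr => x _; apply: eq_bigr => f _.
  by rewrite mul1mx.
Qed.

End Components.

Lemma transvection_unit (F : finFieldType) (N : nat) (x : 'cV[F]_N) (f : 'rV[F]_N) :
  f *m x = 0 -> 1%:M + x *m f \in unitmx.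
Proof.
by move=> fx; have := @unip_unit F N _ _ x f 1%:M fx; rewrite /unip mulmx1.
Qed.

(** * The character ratio as an eigenvalue of the sum of transvections *)

Section TransvectionValue.

Variables (F : finFieldType) (n : nat) (i : Iirr [set: {'GL_n[F]}]).
Hypothesis n_gt1 : (1 < n)%N.
Notation N := n.-1.+1.
Notation X := (glchar i).

Lemma glchar_transv (x : 'cV[F]_N) (f : 'rV[F]_N) :
  x != 0 -> f != 0 -> f *m x = 0 -> X (1%:M + x *m f) = 'chi_i (transv n F).
Proof.
case: n i n_gt1 x f => [|[|p]] // j _ x f nzx nzf fx.
have [g [ug gx fg]] := transvection_frame nzx nzf fx.
have gT : invmx g *m (1%:M + x *m f) *m g = transv_mx p.+2 F.
  rewrite mulmxDr mulmx1 mulmxDl mulVmx // -!mulmxA fg -gx mulmxA mulKmx //.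
  by rewrite mul_delta_mx.
rewrite -(@glcharJ F p.+2 j g _ ug) gT /glchar -[toGL _]/(transv _ _) ifT //.
by rewrite -gT !unitmx_mul unitmx_inv ug transvection_unit.
Qed.

Let R := 'chi_i (transv n F) / 'chi_i 1%g.

Lemma glcharC (A B : 'M[F]_N) : A \in unitmx -> X (A *m B) = X (B *m A).
Proof. by move=> uA; rewrite -(glcharJ _ _ uA) mulKmx. Qed.

Lemma glchar1_gt0 : 0 < X 1%:M.
Proof. by rewrite glchar1 irr1_gt0. Qed.

Lemma sum_transvections_conj (h : 'M[F]_N -> algC) (g : 'M[F]_N) : g \in unitmx ->
  \sum_(x : 'cV_N | x != 0) \sum_(f : 'rV_N | f *m x == 0) h (1%:M + x *m f) =
  \sum_(x : 'cV_N | x != 0) \sum_(f : 'rV_N | f *m x == 0)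
     h (invmx g *m (1%:M + x *m f) *m g).
Proof.
move=> ug; have ug' : invmx g \in unitmx by rewrite unitmx_inv.
rewrite (reindex_inj (can_inj (mulKmx ug'))) /=.
apply: eq_big => [x|x _].
  by rewrite -(inj_eq (can_inj (mulKmx ug))) mulmx0 mulKVmx.
rewrite (reindex_inj (can_inj (mulmxK ug))) /=.
apply: eq_big => [f|f _]; first by rewrite mulmxA mulmxK.
by rewrite mulmxDr mulmx1 mulmxDl mulVmx // !mulmxA.
Qed.

(** The sum is invariant under conjugation, so it may be averaged over GL_n, where the class sum
    formula applies termwise. Each of the q^N - 1 vectors x contributes 1 from f = 0 and the ratio R
    from each of the q^(N-1) - 1 other f. At a singular z both sides are 0. *)
Lemma glchar_eigen :
  transv_eigen ((#|F|%:R ^+ N - 1) * (1 + (#|F|%:R ^+ N.-1 - 1) * R)) X.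
Proof.
move=> g z ug; rewrite (glcharC _ ug).
under eq_bigr => x _ do under eq_bigr => f _ do rewrite (glcharC _ ug) -mulmxA.
move: (z *m g) => {ug}z.
have [uz | nuz] := boolP (z \in unitmx); last first.
  rewrite [X z]/glchar (negPf nuz) mulr0; apply: big1 => x _; apply: big1 => f _.
  by rewrite /glchar unitmx_mul (negPf nuz) andbF.
have G0 : #|[set: {'GL_n[F]}]|%:R != 0 :> algC by rewrite pnatr_eq0 -lt0n cardG_gt0.
apply: (mulfI G0); set S := \sum_(x | _) _.
have -> : #|[set: {'GL_n[F]}]|%:R * S = \sum_(g : {'GL_n[F]}) S.
  by rewrite sumr_const mulr_natl cardsT.
transitivity (\sum_(x : 'cV[F]_N | x != 0) \sum_(f : 'rV[F]_N | f *m x == 0)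
   #|[set: {'GL_n[F]}]|%:R * (X (1%:M + x *m f) / X 1%:M * X z)).
  under eq_bigr => h _ do
    rewrite /S (sum_transvections_conj (fun M => X (M *m z)) (GL_unitmx h)).
  rewrite exchange_big; apply: eq_bigr => x _ /=.
  rewrite exchange_big; apply: eq_bigr => f /eqP fx /=.
  by rewrite -glchar_conj_sum // transvection_unit.
under eq_bigr => x _ do rewrite -mulr_sumr.
rewrite -mulr_sumr; congr (_ * _).
under eq_bigr => x _ do rewrite -mulr_suml.
rewrite -mulr_suml; congr (_ * _).
have -> : #|F|%:R ^+ N - 1 = #|[pred x : 'cV[F]_N | x != 0]|%:R :> algC.
  have -> : #|[pred x : 'cV[F]_N | x != 0]| = (#|F| ^ N).-1.
    by have := cardC1 (0 : 'cV[F]_N); rewrite card_mx muln1 => <-; apply: eq_card.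
  rewrite -natrX -{1}(prednK (_ : 0 < #|F| ^ N)%N) ?expn_gt0; last first.
    by rewrite (ltn_trans _ (finRing_gt1 F)).
  by rewrite -natr1 addrK.
rewrite mulr_natl -sumr_const; apply: eq_bigr => x nzx.
rewrite (bigD1 0) ?mul0mx //= mulmx0 addr0 divff ?gt_eqF ?glchar1_gt0 //; congr (1 + _).
transitivity (\sum_(f : 'rV[F]_N | (f *m x == 0) && (f != 0)) R).
  by apply: eq_bigr => f /andP[/eqP fx nzf]; rewrite glchar_transv // glchar1.
rewrite sumr_const -[LHS]mulr_natl; congr (_ * _).
have := card_row_ker x; have -> : \rank x = 1%N.
  by apply/eqP; rewrite eqn_leq rank_leq_col lt0n mxrank_eq0.
rewrite (cardsD1 0) inE mul0mx eqxx subn1 -natrX /= => <-.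
rewrite natrD addrC addKr; congr (_%:R); apply: eq_card => f.
by rewrite !inE andbC.
Qed.

End TransvectionValue.

(** * Coordinate embeddings for the upper right block *)

Section BlockEmbedding.

Variables (F : finFieldType) (N a b : nat).

(** With a + b = N these are the inclusion of the first a coordinates and the projection onto the
    last b, so [blockP *m A *m blockQ] places [A] in the upper right corner. *)
Definition blockP : 'M[F]_(N, a) := \matrix_(i, j) (i == j :> nat)%:R.
Definition blockQ : 'M[F]_(b, N) := \matrix_(i, j) (j == a + i :> nat)%N%:R.

Lemma blockQP : blockQ *m blockP = 0.
Proof.
apply/matrixP => i j; rewrite !mxE big1 // => l _; rewrite !mxE.
case: eqP => [->|_]; rewrite ?mul0r // [_ == _]gtn_eqF ?mulr0 //.
exact: leq_trans (ltn_ord j) (leq_addr _ _).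
Qed.

Hypothesis abN : (a + b = N)%N.

Let lift_a (l : 'I_a) : (l < N)%N.
Proof. by rewrite -abN ltn_addr. Qed.

Let lift_b (l : 'I_b) : (a + l < N)%N.
Proof. by rewrite -abN ltn_add2l. Qed.

Lemma blockP_trK : blockP^T *m blockP = 1%:M.
Proof.
apply/matrixP => i j; rewrite !mxE (bigD1 (Ordinal (lift_a i))) //= big1 => [|l li].
  by rewrite !mxE /= eqxx mul1r addr0.
rewrite !mxE; case: eqP => [e|_]; last by rewrite mul0r.
by case/eqP: li; apply: val_inj.
Qed.

Lemma blockQ_trK : blockQ *m blockQ^T = 1%:M.
Proof.
apply/matrixP => i j; rewrite !mxE (bigD1 (Ordinal (lift_b i))) //= big1 => [|l li].
  by rewrite !mxE /= eqxx mul1r addr0 eqn_add2l.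
rewrite !mxE; case: eqP => [e|_]; last by rewrite mul0r.
by case/eqP: li; apply: val_inj.
Qed.

Lemma block_entry (A : 'M[F]_(a, b)) (i j : 'I_N) (l : 'I_a) (l' : 'I_b) :
  i = l :> nat -> j = (a + l')%N :> nat -> (blockP *m A *m blockQ) i j = A l l'.
Proof.
move=> il jl; rewrite mxE (bigD1 l') //= big1 => [|k kl].
  rewrite [blockQ _ _]mxE jl eqxx mulr1 addr0 mxE (bigD1 l) //= big1 => [|k kl].
    by rewrite mxE il eqxx mul1r addr0.
  rewrite mxE il; case: eqP => [e|_]; last by rewrite mul0r.
  by case/eqP: kl; apply: val_inj.
rewrite [blockQ _ _]mxE jl eqn_add2l; case: eqP => [e|_]; last by rewrite mulr0.
by case/eqP: kl; apply: val_inj.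
Qed.

Lemma block_entry_row0 (A : 'M[F]_(a, b)) (i j : 'I_N) :
  (a <= i)%N -> (blockP *m A *m blockQ) i j = 0.
Proof.
move=> ai; rewrite mxE big1 // => k _; rewrite mxE big1 ?mul0r // => l _.
by rewrite mxE gtn_eqF ?mul0r // (leq_trans (ltn_ord l)).
Qed.

Lemma block_entry_col0 (A : 'M[F]_(a, b)) (i j : 'I_N) :
  (j < a)%N -> (blockP *m A *m blockQ) i j = 0.
Proof.
move=> ja; rewrite mxE big1 // => k _; rewrite [blockQ _ _]mxE.
by rewrite ltn_eqF ?mulr0 // (leq_trans ja) ?leq_addr.
Qed.

End BlockEmbedding.

(** * Fourier analysis of the character on U and the two rank inequalities *)

Section FourierOnU.

Variables (F : finFieldType) (psi : F -> algC).
Hypothesis psi_char : nontriv_add_char psi.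
Variables (n : nat) (i : Iirr [set: {'GL_n[F]}]).
Hypothesis n_gt1 : (1 < n)%N.
Notation N := n.-1.+1.
Notation X := (glchar i).
Let a := n./2.
Let b := (n - n./2)%N.
Let P := blockP F N a.
Let Q := blockQ F N a b.
Let R := 'chi_i (transv n F) / 'chi_i 1%g.

Let psi0 : psi 0 = 1. Proof. by case: psi_char. Qed.
Let psiD x y : psi (x + y) = psi x * psi y. Proof. by case: psi_char. Qed.

Let abN : (a + b = N)%N.
Proof.
rewrite /a /b subnKC; first by rewrite prednK // ltnW.
by rewrite -{2}[n]odd_double_half -addnn addnCA leq_addr.
Qed.

Let QP : Q *m P = 0. Proof. exact: blockQP. Qed.

Let uU A : unip P Q A \in unitmx. Proof. exact: unip_unit. Qed.

(** This is |U| times the multiplicity of psi_B. As the value of a [component] at the identity, it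
    directly supplies a nonzero function for the upper bound when it does not vanish. *)
Definition Ucoef (B : 'M[F]_(n./2, n - n./2)) : algC := component psi P Q B X 1%:M.

Let UcoefE B : Ucoef B = \sum_A psi (- \tr (B^T *m A)) * X (unip P Q A).
Proof. by apply: eq_bigr => A _; rewrite mulmx1. Qed.

Let blk (g : {'GL_n[F]}) : 'M[F]_(a, b) :=
  \matrix_(k, l) GLval g (inord k) (inord (n./2 + l)).

Let blkK A : blk (toGL (unip P Q A)) = A.
Proof.
apply/matrixP => k l; rewrite mxE toGLK // /unip mxE.
have kN : (k < N)%N by rewrite -abN ltn_addr.
have lN : (a + l < N)%N by rewrite -abN ltn_add2l.
rewrite (block_entry _ (l := k) (l' := l)) ?inordK // mxE -val_eqE /= !inordK //.
by rewrite ltn_eqF ?add0r // (leq_trans (ltn_ord k)) ?leq_addr.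
Qed.

Let unip_inU A : toGL (unip P Q A) \in Uset n F.
Proof.
rewrite inE /inU; apply/forallP => k; apply/forallP => l; rewrite toGLK // /unip.
rewrite [(1%:M + _) k l]mxE [1%:M k l]mxE; apply/andP; split; apply/implyP.
  have [lt_ka | le_ak] := ltnP k n./2; move/eqP/esym => e.
    by rewrite (block_entry_col0 _ _ e) addr0.
  by rewrite (block_entry_row0 _ _ le_ak) addr0.
case/andP => ak la; rewrite (block_entry_row0 _ _ ak) addr0.
by rewrite -val_eqE /= gtn_eqF // (leq_trans la).
Qed.

Let inU_unip g : g \in Uset n F -> toGL (unip P Q (blk g)) = g.
Proof.
rewrite inE => /forallP gU; rewrite -[RHS]GLvalK; congr toGL.
apply/matrixP => k l; have /forallP/(_ l)/andP[/implyP gd /implyP gl] := gU k.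
rewrite /unip mxE [1%:M k l]mxE.
have [lt_ka | le_ak] := ltnP k n./2; have [lt_la | le_al] := ltnP l n./2.
- by rewrite block_entry_col0 // addr0 (eqP (gd _)) // lt_ka lt_la.
- have lb : (l - a < b)%N by rewrite ltn_subLR // abN.
  have kE : k = Ordinal lt_ka :> nat by [].
  have lE : l = (a + Ordinal lb)%N :> nat by rewrite /= subnKC.
  rewrite (block_entry _ kE lE) mxE.
  rewrite -val_eqE /= ltn_eqF ?add0r; last exact: leq_trans le_al.
  by congr (GLval g _ _); apply: val_inj; rewrite /= ?subnKC // inordK.
- by rewrite block_entry_row0 // addr0 (eqP (gl _)) ?le_ak // -val_eqE gtn_eqF // (leq_trans lt_la).
- by rewrite block_entry_row0 // addr0 (eqP (gd _)) // !ltnNge le_ak le_al.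
Qed.

Lemma occursB_Ucoef B : occursB psi 'chi_i B = (Ucoef B != 0).
Proof.
have -> : Ucoef B = \sum_(g in Uset n F) 'chi_i g * (psiB psi B g)^*.
  rewrite UcoefE [RHS](reindex_onto (fun A => toGL (unip P Q A)) blk); last exact: inU_unip.
  apply: eq_big => [A|A _]; first by rewrite unip_inU blkK eqxx.
  rewrite mulrC /glchar uU /psiB add_char_conj //; congr (_ * psi (- \tr (_ *m _))).
  exact/esym/blkK.
rewrite /occursB mulf_eq0 invr_eq0 pnatr_eq0 negb_or andb_idl // => _.
by rewrite -lt0n; apply/card_gt0P; exists (toGL (unip P Q 0)).
Qed.

(** Positive definiteness with the coefficients psi (- tr (B^T A)); the double sum over U repeats
    [Ucoef B] once for each element of U. *)
Lemma Ucoef_ge0 B : 0 <= Ucoef B.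
Proof.
have := glchar_posdef i (fun A => psi (- \tr (B^T *m A))) uU.
have -> : \sum_A \sum_A' psi (- \tr (B^T *m A)) * (psi (- \tr (B^T *m A')))^* *
    X (unip P Q A *m invmx (unip P Q A')) = #|{: 'M[F]_(a, b)}|%:R * Ucoef B.
  rewrite exchange_big mulr_natl -sumr_const; apply: eq_bigr => A' _ /=.
  rewrite UcoefE (reindex_inj (addIr A')); apply: eq_bigr => A _ /=.
  rewrite unipV // -unipD // addrK add_char_conj // -psiD; congr (psi _ * _).
  by rewrite opprK mulmxDr mxtraceD opprD addrNK.
rewrite pmulr_rge0 // ltr0n; apply/card_gt0P; by exists 0.
Qed.

Lemma Ucoef_inv A :
  \sum_B Ucoef B * psi (\tr (B^T *m A)) = (#|F| ^ (a * b))%:R * X (unip P Q A).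
Proof.
under eq_bigr => B _ do rewrite UcoefE mulr_suml.
rewrite exchange_big (bigD1 A) //= [X in _ + X]big1 => [|A' nA].
  rewrite addr0 mulr_natl -card_mx -sumr_const; apply: eq_bigr => B _.
  by rewrite mulrAC -psiD addNr psi0 mul1r.
under eq_bigr => B _ do rewrite mulrAC -psiD addrC -raddfB -mulmxBr.
by rewrite -mulr_suml sum_add_char_trT // subr_eq0 eq_sym (negPf nA) !mul0r.
Qed.

Lemma Ucoef_exists : exists B, Ucoef B != 0.
Proof.
apply/existsP; apply: contraT => /existsPn coef0; have := Ucoef_inv 0.
rewrite unip0 big1 => [/esym/eqP|B _]; last first.
  by have := coef0 B; rewrite negbK => /eqP->; rewrite mul0r.
rewrite mulf_eq0 (gt_eqF (glchar1_gt0 i)) orbF pnatr_eq0 expn_eq0.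
by case: #|F| (finRing_gt1 F).
Qed.

(** The sum [S] over all products x f is evaluated twice: through the values at 1 and at a
    transvection, and by Fourier inversion, where each occurring [B] has positive weight and a
    factor at least q^b q^(a-k). *)
Lemma Ucoef_rank_ratio_ge k : (forall B, Ucoef B != 0 -> (\rank B <= k)%N) ->
  #|F|%:R ^+ b * #|F|%:R ^+ (a - k) <=
    (#|F|%:R ^+ a - 1) * (#|F|%:R ^+ b - 1) * R + #|F|%:R ^+ a + #|F|%:R ^+ b - 1.
Proof.
move=> rkB; set q : algC := #|F|%:R.
have q_ge1 : 1 <= q by rewrite ler1n ltnW // finRing_gt1.
have cnz p p' : #|[pred x : 'M[F]_(p, p') | x != 0]|%:R = q ^+ (p * p') - 1 :> algC.
  have -> : #|[pred x : 'M[F]_(p, p') | x != 0]| = (#|F| ^ (p * p')).-1.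
    by have := cardC1 (0 : 'M[F]_(p, p')); rewrite card_mx => <-; apply: eq_card.
  rewrite /q -natrX -{2}(prednK (_ : 0 < #|F| ^ (p * p'))%N) ?expn_gt0.
    by rewrite -natr1 addrK.
  by rewrite (ltn_trans _ (finRing_gt1 F)).
pose S := \sum_(x : 'cV[F]_a) \sum_(f : 'rV[F]_b) X (unip P Q (x *m f)).
have X1 : X 1%:M != 0 by rewrite gt_eqF ?glchar1_gt0.
have SE : S = X 1%:M * ((q ^+ a - 1) * (q ^+ b - 1) * R + q ^+ a + q ^+ b - 1).
  rewrite /S (bigD1 0) //=.
  under eq_bigr => f _ do rewrite mul0mx unip0.
  rewrite sumr_const card_mx mul1n -[_ *+ _]mulr_natl natrX -/q.
  transitivity (q ^+ b * X 1%:M +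
     \sum_(x : 'cV[F]_a | x != 0) (X 1%:M + (q ^+ b - 1) * (X 1%:M * R))).
    congr (_ + _); apply: eq_bigr => x nzx.
    rewrite (bigD1 0) //= mulmx0 unip0; congr (_ + _).
    rewrite -[b in q ^+ b]mul1n -cnz mulr_natl -sumr_const; apply: eq_bigr => f nzf.
    rewrite /unip !mulmxA -mulmxA glchar_transv //.
    - by rewrite /R glchar1 mulrCA divff ?mulr1 // irr1_neq0.
    - apply: contraNneq nzx => Px0; rewrite -[x]mul1mx -(blockP_trK F abN).
      by rewrite -mulmxA -/P Px0 mulmx0.
    - apply: contraNneq nzf => fQ0; rewrite -[f]mulmx1 -(blockQ_trK F abN).
      by rewrite mulmxA -/Q fQ0 mul0mx.
    - by rewrite -mulmxA [Q *m _]mulmxA QP mul0mx mulmx0.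
  rewrite sumr_const -[_ *+ _]mulr_natl cnz muln1; ring.
have q_gt0 : 0 < q by apply: lt_le_trans q_ge1.
have qab : 0 < (#|F| ^ (a * b))%:R :> algC by rewrite natrX exprn_gt0.
(* For fixed [B], summing over f first leaves q^b for each column x with B^T x = 0, and there are
   q^(a - rank B) of these. *)
have SF : (#|F| ^ (a * b))%:R * S = \sum_B Ucoef B * (q ^+ b * q ^+ (a - \rank B)).
  rewrite mulr_sumr.
  under eq_bigr => x _.
    rewrite mulr_sumr.
    under eq_bigr => f _ do rewrite -Ucoef_inv.
    rewrite exchange_big /=.
    over.
  rewrite exchange_big; apply: eq_bigr => B _ /=.
  under eq_bigr => x _ do rewrite -mulr_sumr.
  rewrite -mulr_sumr; congr (_ * _).
  under eq_bigr => x _.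
    under eq_bigr => f _ do rewrite mulmxA.
    rewrite sum_add_char_tr // mul1n.
    over.
  rewrite -mulr_suml natrX mulrC; congr (_ * _).
  rewrite -natrX -mxrank_tr -card_col_ker -sum1_card natr_sum [RHS]big_mkcond.
  by apply: eq_bigr => x _; rewrite inE; case: eqP.
rewrite -(ler_pM2l (glchar1_gt0 i)) -SE -(ler_pM2l qab) SF mulrA.
have := Ucoef_inv 0; rewrite unip0 => <-.
under eq_bigr => B _ do rewrite mulmx0 mxtrace0 psi0 mulr1.
rewrite mulr_suml; apply: ler_sum => B _.
have [-> | nzB] := eqVneq (Ucoef B) 0; first by rewrite !mul0r.
apply: ler_wpM2l; first exact: Ucoef_ge0.
apply: ler_wpM2l; first by rewrite exprn_ge0 // ltW.
by apply: ler_weXn2l => //; apply/leq_sub2l/rkB.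
Qed.

(** The test function is the component of the character itself at [B], whose value at the identity
    is [Ucoef B]. *)
Lemma Ucoef_rank_ratio_le B r : Ucoef B != 0 -> \rank B = r -> (r < N)%N ->
  #|F|%:R ^+ (N - r).-1 * ((#|F|%:R ^+ N - 1) * (1 + (#|F|%:R ^+ N.-1 - 1) * R)) <=
    #|F|%:R ^+ N.-1 * (#|F|%:R ^+ N + #|F|%:R ^+ (N - r - r) * #|F|%:R ^+ N.-1) :> algC.
Proof.
move=> nzB rkB rN.
apply: (component_eigenvalue_le psi_char (PX := P) (QX := Q) (LX := P^T)
  (B0 := B) (v0 := component psi P Q B X)) => //.
- exact: (blockP_trK F abN).
- by exists 1%:M; exact: nzB.
- exact: component_eigen (glchar_eigen i n_gt1).
- by move=> A z; apply: component_equivariant.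
Qed.

End FourierOnU.

(** * Elementary estimates in the powers of q *)

Section Numerics.

Variables (C : numFieldType) (q R kap : C).
Hypotheses (q_ge2 : 2 <= q) (kap_ge0 : 0 <= kap).

Let rho := R * kap.
Let q_ge0 : 0 <= q. Proof. exact: le_trans q_ge2. Qed.
Let q_ge1 : 1 <= q. Proof. by apply: le_trans q_ge2; rewrite ler1n. Qed.

(** To be read with kap = q^k, al = q^a, be = q^b and x = q^(a-k). The claim, multiplied by (al -
    1)(be - 1), is a sum of nonnegative multiples of the hypotheses and a nonnegative remainder. *)
Lemma ratio_lower (al be x : C) : 1 < al -> 1 < be ->
    kap * al * q <= al * be -> kap * be * q <= al * be -> x * kap = al ->
    be * x <= (al - 1) * (be - 1) * R + al + be - 1 ->
  q - 2 <= q * (R * kap).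
Proof.
rewrite -/rho => al_gt1 be_gt1 kal kbe xE /(ler_wpM2r kap_ge0).
have -> : be * x * kap = al * be by rewrite -xE; ring.
have -> : ((al - 1) * (be - 1) * R + al + be - 1) * kap =
    (al - 1) * (be - 1) * rho + kap * (al + be - 1) by rewrite /rho; ring.
move: rho => {xE}t h.
have al1 : 0 < al - 1 by rewrite subr_gt0.
have be1 : 0 < be - 1 by rewrite subr_gt0.
rewrite -subr_ge0 in kal; rewrite -subr_ge0 in kbe; rewrite -subr_ge0 in h.
rewrite -subr_ge0 -(pmulr_rge0 _ (mulr_gt0 al1 be1)).
have -> : (al - 1) * (be - 1) * (q * t - (q - 2)) =
    q * ((al - 1) * (be - 1) * t + kap * (al + be - 1) - al * be)
    + (al * be - kap * al * q) + (al * be - kap * be * q) + kap * q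
    + (q - 2) * ((al - 1) + (be - 1) + 1) by ring.
have ab_ge0 := addr_ge0 (addr_ge0 (ltW al1) (ltW be1)) ler01.
have q2 : 0 <= q - 2 by rewrite subr_ge0.
by do 4![apply: addr_ge0; last by [assumption | apply: mulr_ge0]]; apply: mulr_ge0.
Qed.

(** To be read with kap = q^k, nu = q^(N-1), x = q^(N-k-1) and y = q^(N-2k). *)
Lemma ratio_upper (nu x y : C) : q <= nu -> 0 <= R * kap -> kap ^+ 2 * q <= nu ->
    x * kap = nu -> y * kap ^+ 2 = q * nu ->
    x * ((q * nu - 1) * (1 + (nu - 1) * R)) <= nu * (q * nu + y * nu) ->
  q * (R * kap) <= q + 12.
Proof.
rewrite -/rho => q_nu rho_ge0 k2 xE yE /(ler_wpM2r (exprn_ge0 2 kap_ge0)).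
have nu_gt0 : 0 < nu by apply: lt_le_trans q_nu; apply: lt_le_trans q_ge1.
have -> : x * ((q * nu - 1) * (1 + (nu - 1) * R)) * kap ^+ 2 =
    nu * ((q * nu - 1) * (kap + (nu - 1) * rho)) by rewrite -xE /rho; ring.
have -> : nu * (q * nu + y * nu) * kap ^+ 2 = nu * (q * nu * (kap ^+ 2 + nu)).
  transitivity (nu * (q * nu * kap ^+ 2 + y * kap ^+ 2 * nu)); first by ring.
  by rewrite yE; ring.
rewrite ler_pM2l //; move: rho rho_ge0 => t t_ge0 h {xE yE}.
have nu_ge1 : 1 <= nu by apply: le_trans q_nu.
have q1_gt0 : 0 < q - 1 by rewrite subr_gt0 (lt_le_trans _ q_ge2) // ltr1n.
have q1_ge0 := ltW q1_gt0.
rewrite -subr_ge0 in k2; rewrite -subr_ge0 in h; rewrite -subr_ge0 in q_nu.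
rewrite -subr_ge0 in nu_ge1; rewrite -subr_ge0.
have qnu_ge0 : 0 <= q * nu - 1.
  have -> : q * nu - 1 = (q - 1) * nu + (nu - 1) by ring.
  by rewrite addr_ge0 // mulr_ge0 // ltW.
(* Elimination of [nu] and [kap]: what remains is t <= q (q + 1) / (q - 1)^2. *)
have h1 : 0 <= q * (q + 1) - (q - 1) ^+ 2 * t.
  rewrite -(pmulr_rge0 _ (exprn_gt0 2 nu_gt0)).
  have -> : nu ^+ 2 * (q * (q + 1) - (q - 1) ^+ 2 * t) =
      q * (q * nu * (kap ^+ 2 + nu) - (q * nu - 1) * (kap + (nu - 1) * t))
      + q * nu * (nu - kap ^+ 2 * q) + q * (q * nu - 1) * kap
      + (nu * (q - 1) * (nu - q) + (nu - 1) * nu * (q - 1) + (nu - 1) * (nu - q)) * t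
    by ring.
  have nu_ge0 := ltW nu_gt0.
  have qnu := mulr_ge0 q_ge0 nu_ge0.
  have qq := mulr_ge0 q_ge0 qnu_ge0; have nq := mulr_ge0 nu_ge0 q1_ge0.
  have n1n := mulr_ge0 nu_ge1 nu_ge0.
  apply: addr_ge0; first by do 2![apply: addr_ge0; last by [assumption | apply: mulr_ge0]];
    apply: mulr_ge0.
  by apply: mulr_ge0 => //; do 2![apply: addr_ge0; last by [assumption | apply: mulr_ge0]];
    apply: mulr_ge0.
rewrite -(pmulr_rge0 _ (exprn_gt0 2 q1_gt0)).
(* With the constant 12 the remaining polynomial, expanded at q = 2, has only positive
   coefficients. *)
have -> : (q - 1) ^+ 2 * (q + 12 - q * t) =
    q * (q * (q + 1) - (q - 1) ^+ 2 * t)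
    + (2 + 13 * (q - 2) + 9 * (q - 2) ^+ 2) by ring.
have q2 : 0 <= q - 2 by rewrite subr_ge0.
apply: addr_ge0; first exact: mulr_ge0.
apply: addr_ge0; last by apply: mulr_ge0 => //; apply: exprn_ge0.
by apply: addr_ge0 => //; apply: mulr_ge0.
Qed.

End Numerics.

(** * Combination of the two bounds into the asymptotic formula *)

Theorem theorem3p1 (n k : nat) :
  (k < n./2)%N ->
  forall eps : algC, 0 < eps ->
  exists Q : nat,
    forall (F : finFieldType) (psi : F -> algC),
      nontriv_add_char psi -> (Q < #|F|)%N ->
      forall i : Iirr [set: {'GL_n[F]}],
        Urank psi 'chi_i = k ->
        `| ('chi_i (transv n F) / 'chi_i 1%g) * (#|F| ^ k)%:R - 1 | < eps.
Proof.
move=> k_lt eps eps_gt0.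
pose a := n./2; pose b := (n - a)%N.
have ab : (a + a <= n)%N by rewrite addnn -[leqRHS]odd_double_half leq_addl.
have {}k_lt : (k < a)%N by [].
have n_gt1 : (1 < n)%N by lia.
have a_gt0 : a != 0 by lia.
have b_gt0 : b != 0 by lia.
have kab : ((k + a).+1 <= a + b)%N by lia.
have kbb : ((k + b).+1 <= a + b)%N by lia.
have kN : (k < n.-1.+1)%N by lia.
have n1_gt0 : (1 <= n.-1)%N by lia.
have k2n : ((k * 2).+1 <= n.-1)%N by lia.
have n1k : ((n.-1.+1 - k).-1 + k = n.-1)%N by lia.
have n1kk : (n.-1.+1 - k - k + k * 2 = n.-1.+1)%N by lia.
(* The bounds give |R q^k - 1| <= 12 / q, so the threshold depends on [eps] alone. *)
exists (Num.bound (12 / eps)) => F psi psi_char ltQ i rk.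
set R := 'chi_i _ / _; set q : algC := #|F|%:R; rewrite natrX -/q.
have q_ge2 : 2 <= q by rewrite ler_nat finRing_gt1.
have q_gt1 : 1 < q by apply: lt_le_trans q_ge2; rewrite ltr1n.
have q_ge0 : 0 <= q by rewrite ler0n.
have q_gt0 : 0 < q by apply: lt_trans q_gt1.
have q_mono s t : (s <= t)%N -> q ^+ s <= q ^+ t by apply/ler_weXn2l/ltW.
have rkle B : Ucoef psi i B != 0 -> (\rank B <= k)%N.
  rewrite -occursB_Ucoef // -rk => occB; exact: leq_bigmax_cond.
have lower : q - 2 <= q * (R * q ^+ k).
  have := Ucoef_rank_ratio_ge psi_char n_gt1 rkle; rewrite -/R -/q -/a -/b => h.
  apply: (@ratio_lower _ q R (q ^+ k) _ _ (q ^+ a) (q ^+ b) (q ^+ (a - k))) => //.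
  - exact: exprn_ge0.
  - by rewrite exprn_egt1.
  - by rewrite exprn_egt1.
  - by rewrite -exprD -exprSr -exprD q_mono.
  - by rewrite -exprD -exprSr -exprD q_mono.
  - by rewrite -exprD subnK // ltnW.
have rho_ge0 : 0 <= R * q ^+ k.
  by rewrite -(pmulr_rge0 _ q_gt0) (le_trans _ lower) // subr_ge0.
have upper : q * (R * q ^+ k) <= q + 12.
  (* A maximum over an empty family would be 0 without a witness; some [Ucoef] is nonzero, so the
     rank k is attained. *)
  have [B occB rkB] : exists2 B, occursB psi 'chi_i B & \rank B = k.
    have [B0 nzB0] := Ucoef_exists psi_char i.
    have [|B occB rkB] := @eq_bigmax_cond _ [pred B | occursB psi 'chi_i B] mxrank.
      by apply/card_gt0P; exists B0; rewrite inE occursB_Ucoef.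
    by exists B => //; rewrite -rkB.
  rewrite occursB_Ucoef // in occB.
  have := Ucoef_rank_ratio_le psi_char n_gt1 occB rkB kN; rewrite -/R -/q => h.
  apply: (@ratio_upper _ q R (q ^+ k) _ _ (q ^+ n.-1)
    (q ^+ (n.-1.+1 - k).-1) (q ^+ (n.-1.+1 - k - k))) => //.
  - exact: exprn_ge0.
  - by rewrite -{1}[q]expr1 q_mono.
  - by rewrite -exprM -exprSr q_mono.
  - by rewrite -exprD n1k.
  - by rewrite -exprM -exprD n1kk exprS.
  - by rewrite -exprS.
have eps_q : 12 / q < eps.
  rewrite ltr_pdivrMr // mulrC -ltr_pdivrMr //.
  apply: lt_trans (archi_boundP _) _; last by rewrite ltr_nat.
  by rewrite divr_ge0 // ltW.
apply: le_lt_trans eps_q; rewrite ler_pdivlMr // -[X in _ * X](gtr0_norm q_gt0).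
rewrite -normrM mulrBl mul1r mulrC real_ler_norml; last first.
  by rewrite realB ?ger0_real // mulr_ge0.
apply/andP; split; last by rewrite lerBlDl.
by rewrite lerBrDl (le_trans _ lower) // lerD2l lerN2 ler_nat.
Qed.
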